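(* In constructive mathematics, consider the statement: ''For any partially ordered set $(X,\sim)$, with $x<y$ defined as $x\sim y$ and $\neg(x=y)$: if for all $x,y\in X$, $\neg(y<x)$ implies $x\sim y$, then $\sim$ is total and equality on $X$ is decidable.'' This statement implies the weak law of excluded middle: for every proposition $P$, either $\neg P$ or $\neg\neg P$.
   Context: The setting is constructive mathematics: no use of the law of excluded middle. A partially ordered set is a set $X$ with a binary relation $\sim$ (respecting equality) that is reflexive ($x\sim x$), transitive ($x\sim y$ and $y\sim z$ imply $x\sim z$) and antisymmetric ($x\sim y$ and $y\sim x$ imply $x=y$). The relation $\sim$ is total if for all $x,y$, $x\sim y$ or $y\sim x$. Equality is decidable if for all $x,y$, $x=y$ or $\neg(x=y)$. *)

(* Defs.v *)
From Corelib Require Import RelationClasses Morphisms.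

(* Sets are Bishop sets: a type with its own equality [eqX], an arbitrary
   equivalence relation which every relation on the set has to respect.
   The constructive logic is that of Prop; no axiom is loaded here. *)

Record partially_ordered_set (X : Type) (eqX sim : X -> X -> Prop) : Prop := {
  pos_eq_equiv : Equivalence eqX;
  pos_respects : Proper (eqX ==> eqX ==> iff) sim;
  pos_refl : forall x, sim x x;
  pos_trans : forall x y z, sim x y -> sim y z -> sim x z;
  pos_antisym : forall x y, sim x y -> sim y x -> eqX x y
}.

Definition strict (X : Type) (eqX sim : X -> X -> Prop) (x y : X) : Prop :=
  sim x y /\ ~ eqX x y.

Definition total (X : Type) (sim : X -> X -> Prop) : Prop :=
  forall x y, sim x y \/ sim y x.

Definition decidable_equality (X : Type) (eqX : X -> X -> Prop) : Prop :=
  forall x y, eqX x y \/ ~ eqX x y.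

Arguments partially_ordered_set {X} eqX sim.
Arguments strict {X} eqX sim x y.
Arguments total {X} sim.
Arguments decidable_equality {X} eqX.

Definition weak_law_of_excluded_middle : Prop := forall P : Prop, ~ P \/ ~ ~ P.

(* Main.v *)
(* Order the booleans by [false < true] when [P] holds and collapse the two
   points when [~ P] holds.  Every relation involved is a negative statement
   about [P], so the hypothesis on [<] holds constructively, while deciding
   [true = false] in this set decides [~ P]. *)

Require Import Defs.

Definition sim_when (P : Prop) (x y : bool) : Prop :=
  P -> x = true -> y = true.

(** Taking the symmetric part of the preorder [sim_when P] as equality makes antisymmetry hold by
    definition. *)
Definition eq_when (P : Prop) (x y : bool) : Prop :=
  sim_when P x y /\ sim_when P y x.

Lemma sim_when_partially_ordered (P : Prop) :
  partially_ordered_set (eq_when P) (sim_when P).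
Proof.
  split; unfold eq_when, sim_when.
  - split; red; intuition.
  - intros x x' Hx y y' Hy; intuition.
  - auto.
  - auto.
  - auto.
Qed.

Lemma sim_when_of_not_strict (P : Prop) (x y : bool) :
  ~ strict (eq_when P) (sim_when P) y x -> sim_when P x y.
Proof.
  (* The goal is an implication from [P], so [p] is at hand without deciding [P]; only [y = false]
     is left to refute. *)
  intros H p Hx; destruct y; [reflexivity | exfalso].
  apply H; split.
  - intros _ _; exact Hx.
  (* Under [p], equality of the two points would turn [x = true] into [false = true]. *)
  - intros [_ Hxy]; discriminate (Hxy p Hx).
Qed.

Lemma eq_when_true_false (P : Prop) : eq_when P true false <-> ~ P.
Proof.
  split.
  - intros [H _] p; discriminate (H p eq_refl).
  - intros np; split; intros p; contradiction.
Qed.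

Theorem theorem16 :
  (forall (X : Type) (eqX sim : X -> X -> Prop),
      partially_ordered_set eqX sim ->
      (forall x y : X, ~ strict eqX sim y x -> sim x y) ->
      total sim /\ decidable_equality eqX) ->
  weak_law_of_excluded_middle.
Proof.
  intros H P.
  destruct (H bool (eq_when P) (sim_when P) (sim_when_partially_ordered P)
              (sim_when_of_not_strict P)) as [_ Hdec].
  (* This pair is equal exactly when [~ P]. *)
  destruct (Hdec true false) as [e | ne]; [left | right].
  - apply eq_when_true_false; exact e.
  - intros np; apply ne, eq_when_true_false; exact np.
Qed.
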